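(* Let $\mathbb{F}=\mathbb{R}$ or $\mathbb{C}$, let $n\ge1$, let $\mathcal{S}\subseteq\mathcal{S}'\subseteq\mathbb{F}^n$ be linear subspaces, let $p=\dim(\mathcal{S})\ge1$ and $q=\dim(\mathcal{S}')-\dim(\mathcal{S})$, and assume $q\le p$. Let $\mathcal{M}_{\mathrm{sym}}(\mathcal{S},\mathcal{S}'):=\{A\in\mathrm{Sym}(n):\mathcal{S}+A\mathcal{S}=\mathcal{S}'\}$. Let $V\in\mathbb{F}^{n\times p}$ have orthonormal columns with $\operatorname{Im}(V)=\mathcal{S}$, and define $\mathcal{M}_{\mathrm{sym,T}}(\mathcal{S},\mathcal{S}'):=\{A\in\mathcal{M}_{\mathrm{sym}}(\mathcal{S},\mathcal{S}'):V^*AV\in\mathrm{GL}(p)\}$. Then: (i) $\mathcal{M}_{\mathrm{sym,T}}(\mathcal{S},\mathcal{S}')$ is non-empty, and independent of the choice of $V$. (ii) $\mathcal{M}_{\mathrm{sym,T}}(\mathcal{S},\mathcal{S}')$ is a dense open subset of $\mathcal{M}_{\mathrm{sym}}(\mathcal{S},\mathcal{S}')$. (iii) $\mathcal{M}_{\mathrm{sym,T}}(\mathcal{S},\mathcal{S}')$ is an embedded submanifold of $\mathcal{M}_{\mathrm{sym}}(\mathcal{S},\mathcal{S}')$ of the same dimension as $\mathcal{M}_{\mathrm{sym}}(\mathcal{S},\mathcal{S}')$.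
   Context: $A\mathcal{S}=\{Ax:x\in\mathcal{S}\}$. $\mathrm{Sym}(n)$ is the set of Hermitian matrices in $\mathbb{F}^{n\times n}$, a real vector space with its standard smooth structure; $\mathrm{GL}(p)$ is the set of invertible matrices in $\mathbb{F}^{p\times p}$. All sets of matrices carry the subset topology. Under the stated hypotheses $\mathcal{M}_{\mathrm{sym}}(\mathcal{S},\mathcal{S}')$ is a smooth embedded real submanifold of $\mathrm{Sym}(n)$ of dimension $\alpha(n(n-1)/2-p(n-p-q))+n$, with $\alpha=1$ if $\mathbb{F}=\mathbb{R}$ and $\alpha=2$ if $\mathbb{F}=\mathbb{C}$; this is the manifold structure referred to in (iii). *)

(* Defs.v *)
From HB Require Import structures.
From mathcomp Require Import all_boot all_order all_algebra.
From mathcomp Require Import complex.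
From mathcomp Require Import all_classical all_reals all_analysis.
Import Order.TTheory GRing.Theory Num.Theory.
Import numFieldNormedType.Exports.

Set Implicit Arguments.
Unset Strict Implicit.
Unset Printing Implicit Defensive.

Local Open Scope classical_set_scope.
Local Open Scope ring_scope.

Inductive scalar_kind := RealScalars | ComplexScalars.

Definition scalarF (R : realType) (k : scalar_kind) : numFieldType :=
  match k with
  | RealScalars => R
  | ComplexScalars => R[i]
  end.

(* The dimension of the scalar field over the reals. *)
Definition alpha (k : scalar_kind) : nat :=
  match k with RealScalars => 1%N | ComplexScalars => 2%N end.

Definition scalar_conj (R : realType) (k : scalar_kind) :
    scalarF R k -> scalarF R k :=
  match k with
  | RealScalars => fun x : R => x
  | ComplexScalars => fun z : R[i] => conjc z
  end.

Definition scalar_Re (R : realType) (k : scalar_kind) : scalarF R k -> R :=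
  match k with
  | RealScalars => fun x : R => x
  | ComplexScalars => fun z : R[i] => complex.Re z
  end.

Definition scalar_Im (R : realType) (k : scalar_kind) : scalarF R k -> R :=
  match k with
  | RealScalars => fun _ : R => 0
  | ComplexScalars => fun z : R[i] => complex.Im z
  end.

Definition adjmx (R : realType) (k : scalar_kind) (m n : nat)
    (A : 'M[scalarF R k]_(m, n)) : 'M[scalarF R k]_(n, m) :=
  (map_mx (@scalar_conj R k) A)^T.

(* 'M[R[i]]_n is a normed module over R[i] only, whereas real smoothness needs
   one over R; [realify] is the R-linear homeomorphism onto its image that
   records real and imaginary parts.  For real scalars the second component
   is 0. *)
Definition realify (R : realType) (k : scalar_kind) (n : nat)
    (A : 'M[scalarF R k]_n) : 'M[R]_n * 'M[R]_n :=
  (map_mx (@scalar_Re R k) A, map_mx (@scalar_Im R k) A).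

Section Smooth.
Variables (R : realType).

(* In finite dimension, x |-> 'd f x is C^r iff x |-> 'd f x v is for all v. *)
Fixpoint Cr_on (r : nat) (V W : normedModType R) (U : set V) (f : V -> W) :
    Prop :=
  match r with
  | 0%N => forall x, U x -> {for x, continuous f}
  | r'.+1 => (forall x, U x -> differentiable f x) /\
             (forall v : V, Cr_on r' U (fun x => 'd f x v))
  end.

Definition smooth_on (V W : normedModType R) (U : set V) (f : V -> W) : Prop :=
  forall r, Cr_on r U f.

(* Smoothness on a subset that need not be open: f extends, near each of its
   points, to a smooth map of the ambient space. *)
Definition smooth_map (V W : normedModType R) (X : set V) (f : V -> W) : Prop :=
  forall x, X x -> exists U : set V, exists g : V -> W,
    [/\ open U, U x, smooth_on U g & forall y, U y -> X y -> f y = g y].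

Definition open_in (T : topologicalType) (M N : set T) : Prop :=
  exists2 O : set T, open O & N = O `&` M.

Definition dense_in (T : topologicalType) (M N : set T) : Prop :=
  N `<=` M /\ M `<=` closure N.

(* (U, phi) is a smooth chart of M with values in R^m: a diffeomorphism, for
   the smooth structure induced by the ambient space E, from U (open in M)
   onto an open subset of R^m.  The values of phi off U are irrelevant. *)
Definition smooth_chart (E : normedModType R) (M : set E) (m : nat)
    (U : set E) (phi : E -> 'rV[R]_m) : Prop :=
  [/\ open_in M U, open (phi @` U), smooth_map U phi &
      exists2 psi : 'rV[R]_m -> E,
        smooth_on (phi @` U) psi & forall x, U x -> psi (phi x) = x].

(* N is an embedded l-dimensional submanifold of the m-dimensional manifold M:
   around each point of N, some chart of M flattens N onto R^l x {0}. *)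
Definition embedded_submanifold (E : normedModType R) (M : set E) (m : nat)
    (N : set E) (l : nat) : Prop :=
  [/\ N `<=` M, (l <= m)%N &
      forall x, N x -> exists U : set E, exists phi : E -> 'rV[R]_m,
        [/\ smooth_chart M U phi, U x &
            phi @` (U `&` N) =
            phi @` U `&` [set y | forall i : 'I_m, (l <= i)%N -> y ord0 i = 0]]].

End Smooth.

Section Msym.
Variables (R : realType) (k : scalar_kind) (n : nat).
Local Notation F := (scalarF R k).

Definition SymF : set 'M[F]_n := [set A | adjmx A = A].

Definition dim_Sym : nat := (alpha k * (n * n.-1)./2 + n)%N.

Definition Msym (S S' : {vspace 'cV[F]_n}) : set 'M[F]_n :=
  [set A | SymF A /\ (S + linfun (mulmx A) @: S)%VS = S'].

(* For p = \dim S and q = \dim S' - \dim S one has p (n - p - q) <= n (n-1) / 2,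
   so no subtraction is truncated. *)
Definition dim_Msym (p q : nat) : nat :=
  (alpha k * ((n * n.-1)./2 - p * (n - p - q)) + n)%N.

Definition orthonormal_basis_mx (p : nat) (S : {vspace 'cV[F]_n})
    (V : 'M[F]_(n, p)) : Prop :=
  adjmx V *m V = 1%:M /\
  limg (linfun (mulmx V : 'cV[F]_p -> 'cV[F]_n)) = S.

Definition MsymT (S S' : {vspace 'cV[F]_n}) (p : nat) (V : 'M[F]_(n, p)) :
    set 'M[F]_n :=
  [set A | Msym S S' A /\ adjmx V *m A *m V \in unitmx].

End Msym.

(* Main.v *)
(** Let the rows of [D] be a basis of the linear forms vanishing on [S'].  For
    Hermitian [A], the inclusion [A S <= S'] is the linear condition
    [D A V = 0], and once it holds, [S + A S = S'] says that the matrix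
    [[V, A V]] has rank at least [dim S'], an open condition.  So
    [Msym S S'] is open in a real subspace of the Hermitian matrices, and
    [MsymT] is cut out by one more open condition; linear coordinates adapted
    to these subspaces are the required charts.  The dimension comes from
    rank-nullity, [A |-> D A V] being onto on Hermitian matrices.

    Density: adding [t V V^*] to [A] does not change [S + A S] and turns
    [V^* A V] into [V^* A V + t I], which is invertible for all but finitely
    many [t].  Non-emptiness: take [V V^* + B + B^*] with [B = W J V^*], where
    [W] spans a complement of [S] in [S'] orthogonal to [S] and [J] is the
    [q * p] partial identity, which is onto because [q <= p]. *)
Require Import Defs.
From HB Require Import structures.
From mathcomp Require Import all_boot all_order all_algebra.
From mathcomp Require Import zify ring.
From mathcomp Require Import complex.
From mathcomp Require Import all_classical all_reals all_analysis.
Import Order.TTheory GRing.Theory Num.Theory.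
Import numFieldNormedType.Exports.
Local Open Scope classical_set_scope.
Local Open Scope ring_scope.

Set Implicit Arguments.
Unset Strict Implicit.
Unset Printing Implicit Defensive.

(** * Submanifolds that are open in linear subspaces *)

Lemma continuous_sum (R : numFieldType) (T : topologicalType)
    (V : normedModType R) (I : Type) (r : seq I) (F : I -> T -> V) :
  (forall i, continuous (F i)) ->
  continuous (fun x => \sum_(i <- r) F i x).
Proof. by move=> cF; apply: continuous_big => //; exact: add_continuous. Qed.

Lemma continuous_scaler (R : numFieldType) (T : topologicalType)
    (V : normedModType R) (g : T -> R) (v : V) :
  continuous g -> continuous (fun x => g x *: v).
Proof. by move=> cg x; apply: cvgZr_tmp; exact: cg. Qed.

Lemma continuous_mx_comb (R : numFieldType) (T : topologicalType) (m n : nat)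
    (V : normedModType R) (g : T -> 'M[R]_(m, n)) (h : 'I_m -> 'I_n -> V) :
  continuous g -> continuous (fun x => \sum_(i < m) \sum_(j < n) g x i j *: h i j).
Proof.
move=> cg; apply: continuous_sum => i; apply: continuous_sum => j.
apply: continuous_scaler => x.
exact: (continuous_comp (cg x) (@coord_continuous R m n i j (g x))).
Qed.

(** Expanding in the basis [delta_mx] exhibits [f] as a finite combination of coordinates. *)
Lemma linear_mx_continuous (R : numFieldType) (m n : nat)
    (V : normedModType R) (f : {linear 'M[R]_(m, n) -> V}) : continuous f.
Proof.
have -> : (f : _ -> _) =
    fun A => \sum_(i < m) \sum_(j < n) A i j *: f (delta_mx i j).
  apply/funext => A; rewrite {1}(matrix_sum_delta A) linear_sum.
  by apply: eq_bigr => i _; rewrite linear_sum; apply: eq_bigr => j _; rewrite linearZ.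
by apply: (@continuous_mx_comb _ _ m n V id) => A; exact: cvg_id.
Qed.

Lemma linear_mx_pair_continuous (R : numFieldType) (m n m' n' : nat)
    (V : normedModType R)
    (f : {linear ('M[R]_(m, n) * 'M[R]_(m', n'))%type -> V}) : continuous f.
Proof.
have -> : (f : _ -> _) =
    fun x => \sum_(i < m) \sum_(j < n) x.1 i j *: f (delta_mx i j, 0) +
             \sum_(i < m') \sum_(j < n') x.2 i j *: f (0, delta_mx i j).
  apply/funext => -[A B] /=.
  transitivity (f ((A, 0) + (0, B)));
    first by congr (f _); congr (_, _); rewrite ?addr0 ?add0r.
  rewrite linearD; congr (_ + _).
    transitivity (f (\sum_(i < m) \sum_(j < n) A i j *: (delta_mx i j, 0))).
      congr (f _); rewrite [LHS]surjective_pairing [RHS]surjective_pairing /=.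
      rewrite !raddf_sum /=; congr (_, _).
        by rewrite {1}(matrix_sum_delta A); apply: eq_bigr => i _; rewrite raddf_sum.
      by rewrite big1// => i _; rewrite raddf_sum big1// => j _; rewrite /= scaler0.
    do 2!(rewrite linear_sum; apply: eq_bigr => ? _).
    by rewrite linearZ.
  transitivity (f (\sum_(i < m') \sum_(j < n') B i j *: (0, delta_mx i j))).
    congr (f _); rewrite [LHS]surjective_pairing [RHS]surjective_pairing /=.
    rewrite !raddf_sum /=; congr (_, _).
      by rewrite big1// => i _; rewrite raddf_sum big1// => j _; rewrite /= scaler0.
    by rewrite {1}(matrix_sum_delta B); apply: eq_bigr => i _; rewrite raddf_sum.
  do 2!(rewrite linear_sum; apply: eq_bigr => ? _).
  by rewrite linearZ.
by move=> x; apply: cvgD; apply: continuous_mx_comb => y; [exact: cvg_fst|exact: cvg_snd].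
Qed.

Lemma smooth_on_cst (R : realType) (V W : normedModType R) (U : set V) (c : W) :
  smooth_on U (fun _ : V => c).
Proof.
move=> r; elim: r c => [|r IHr] c /=; first by move=> x _; exact: cst_continuous.
split=> [x _|v]; first exact: differentiable_cst.
have -> : (fun x : V => 'd (fun _ : V => c) x v) = fun _ => 0.
  by apply/funext => x; rewrite (_ : (fun _ : V => c) = cst c)// diff_cst.
exact: IHr.
Qed.

(** The differential of [f] is [f] at every point, so each directional derivative is constant. *)
Lemma smooth_on_linear (R : realType) (V W : normedModType R) (U : set V)
    (f : {linear V -> W}) : continuous f -> smooth_on U f.
Proof.
move=> cf [|r] /=; first by move=> x _; exact: cf.
split=> [x _|v]; first exact: linear_differentiable.
have -> : (fun x : V => 'd f x v) = fun _ => f v.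
  by apply/funext => x; rewrite diff_lin.
exact: smooth_on_cst.
Qed.

Lemma smooth_map_linear (R : realType) (V W : normedModType R) (X : set V)
    (f : {linear V -> W}) : continuous f -> smooth_map X f.
Proof.
move=> cf x Xx; exists setT, f; split=> //; first exact: openT.
exact: smooth_on_linear.
Qed.

(** These are coordinates in a basis of [M] that begins with a basis of [L]. As charts are total
    functions, [phi] is defined on all of [E], but [psi] undoes it only on [M]. *)
Lemma flag_coordinates (K : fieldType) (E : vectType K) (L M : {vspace E}) (l m : nat) :
  (L <= M)%VS -> \dim L = l -> \dim M = m ->
  exists (phi : {linear E -> 'rV[K]_m}) (psi : {linear 'rV[K]_m -> E}),
    [/\ cancel psi phi, forall y, psi y \in M,
        forall x, x \in M -> psi (phi x) = x &
        forall y, psi y \in L <-> forall i : 'I_m, (l <= i)%N -> y ord0 i = 0].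
Proof.
move=> LM dL dM.
have LC : (L + (M :\: L) = M)%VS by rewrite addvC addv_diff (addv_idPl LM).
have dLC : directv (L + (M :\: L)).
  by apply/directv_addP; rewrite capvC capv_diff.
have sL : size (vbasis L) = l by rewrite size_tuple.
have bM : basis_of M (vbasis L ++ vbasis (M :\: L)).
  by rewrite -[X in basis_of X _]LC; apply: cat_basis => //; exact: vbasisP.
have sX : size (vbasis L ++ vbasis (M :\: L)) == m 
  by rewrite size_tuple -dM; apply/eqP; symmetry; exact: (size_basis bM).
pose X := Tuple sX; have fX : free X := basis_free bM.
have spX : (<<X>> = M)%VS := span_basis bM.
have phiL : linear (fun x => \row_i coord X i x).
  by move=> a x y; apply/rowP => i; rewrite !mxE linearP.
have psiL : linear (fun y : 'rV[K]_m => \sum_(i < m) y ord0 i *: X`_i).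
  move=> a x y; rewrite scaler_sumr -big_split; apply: eq_bigr => i _.
  by rewrite !mxE scalerDl scalerA.
pose phi : {linear E -> 'rV[K]_m} := HB.pack (fun x => \row_i coord X i x)
  (GRing.isLinear.Build _ _ _ _ _ phiL).
pose psi : {linear 'rV[K]_m -> E} :=
  HB.pack (fun y : 'rV[K]_m => \sum_(i < m) y ord0 i *: X`_i)
  (GRing.isLinear.Build _ _ _ _ _ psiL).
have psiK : cancel psi phi.
  by move=> y; apply/rowP => i; rewrite /= mxE (coord_sum_free _ _ fX).
have memX i : (i < m)%N -> X`_i \in M.
  by move=> im; rewrite -spX memv_span// mem_nth// size_tuple.
exists phi, psi; split=> //.
- by move=> y; apply: memv_suml => i _; rewrite memvZ// memX.
- move=> x; rewrite -spX => /coord_span {2}->; apply: eq_bigr => i _.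
  by rewrite mxE.
move=> y; split=> [yL i li|y0]; last first.
  apply: memv_suml => i _; case: (ltnP i l) => [il|/y0->]; last by rewrite scale0r mem0v.
  by rewrite memvZ//= nth_cat sL il vbasis_mem// mem_nth// sL.
have im : (l <= m)%N by rewrite -dL -dM dimvS.
(* A vector of [L] involves only basis vectors of index below [l], and these have no coordinate of
   index [i >= l]. *)
rewrite -[y]psiK (coord_vbasis yL) mxE linear_sum big1//= => j _.
have jl : (j < l)%N by rewrite -dL.
have -> : (vbasis L)`_j = X`_(widen_ord im (Ordinal jl)) by rewrite /= nth_cat sL jl.
have c0 : coord X i X`_(widen_ord im (Ordinal jl)) = 0.
  rewrite (coord_free _ _ fX); case: eqVneq => // ij.
  by move: li; rewrite leqNgt -ij /= jl.
by rewrite linearZ; exact: (etrans (congr1 _ c0) (mulr0 _)).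
Qed.

(** One linear chart serves all points. Its domain is [M] cut by the smaller open set [O2]; on it,
    belonging to the submanifold reduces to belonging to [L]. *)
Lemma embedded_open_in_subspaces (R : realType) (n l m : nat)
    (L M : {vspace ('M[R]_n * 'M[R]_n)%type})
    (O1 O2 : set ('M[R]_n * 'M[R]_n)%type) :
  (L <= M)%VS -> \dim L = l -> \dim M = m ->
  open O2 -> O2 `<=` O1 ->
  embedded_submanifold ([set` M] `&` O1) m ([set` L] `&` O2) l.
Proof.
move=> LM dL dM oO2 O21; split.
- by move=> x [/= xL xO]; split; [exact: (subvP LM)|exact: O21].
- by rewrite -dL -dM dimvS.
have [phi [psi [psiK psiM phiK psiL]]] := flag_coordinates LM dL dM.
(* Turning images under [phi] into preimages under [psi] makes their openness a consequence of the
   continuity of [psi]. *)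
have imphi A : phi @` ([set` M] `&` A) = psi @^-1` A.
  apply/seteqP; split=> [_ [x [xM xA] <-]|y yA] /=; first by rewrite phiK.
  by exists (psi y); [split; [exact: psiM|]|exact: psiK].
move=> x [/= xL xO]; exists ([set` M] `&` O2), phi; split.
- split.
  + exists O2 => //; apply/seteqP; split=> [y [yM yO]|y [yO [yM _]]]; last by split.
    by split=> //; split=> //; exact: O21.
  + rewrite imphi; apply: open_comp => // y _; exact: linear_mx_continuous.
  + exact/smooth_map_linear/linear_mx_pair_continuous.
  + exists psi; first exact/smooth_on_linear/linear_mx_continuous.
    by move=> y [yM _]; exact: phiK.
- by split=> //; exact: (subvP LM).
have -> : [set` M] `&` O2 `&` ([set` L] `&` O2) = [set` M] `&` ([set` L] `&` O2).
  by apply/seteqP; split=> [y [[? ?] [? ?]]|y [? [? ?]]].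
rewrite !imphi; apply/seteqP; split=> y /= [].
  by move=> /psiL ? ?.
by move=> ? /psiL.
Qed.

(** * Real dimension counts *)

Lemma dim_onto (K : fieldType) (aT rT : vectType K) (f : {linear aT -> rT})
    (U : {vspace aT}) (W : {vspace rT}) :
  (forall x, x \in U -> f x \in W) ->
  (forall w, w \in W -> exists2 u, u \in U & f u = w) ->
  \dim U = (\dim (U :&: lker (linfun f)) + \dim W)%N.
Proof.
move=> fUW fsurj; rewrite -(limg_ker_dim (linfun f) U); congr (_ + \dim _)%N.
apply/vspaceP => w; apply/memv_imgP/idP => [[u uU ->]|/fsurj[u uU <-]].
  by rewrite lfunE fUW.
by exists u => //; rewrite lfunE.
Qed.

Lemma dim_injective_onto (K : fieldType) (aT rT : vectType K)
    (f : {linear aT -> rT}) (U : {vspace aT}) (W : {vspace rT}) :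
  (forall x, x \in U -> f x \in W) ->
  (forall x, x \in U -> f x = 0 -> x = 0) ->
  (forall w, w \in W -> exists2 u, u \in U & f u = w) ->
  \dim U = \dim W.
Proof.
move=> fUW finj fsurj; rewrite (dim_onto fUW fsurj).
suff -> : (U :&: lker (linfun f) = 0)%VS by rewrite dimv0.
apply/vspaceP => x; rewrite memv_cap memv_ker lfunE memv0.
apply/andP/eqP => [[xU /eqP]|->]; first exact: finj.
by rewrite mem0v linear0.
Qed.

Lemma dim_fullmx (K : fieldType) (m n : nat) :
  \dim {: 'M[K]_(m, n)} = (m * n)%N.
Proof. by rewrite dimvf; exact: dim_matrix. Qed.

(** * Symmetric and skew-symmetric matrices *)

Section RealSymmetric.
Variables (K : numFieldType) (n : nat).

Definition trmx_sub (A : 'M[K]_n) : 'M[K]_n := A^T - A.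
Fact trmx_sub_linear : linear trmx_sub.
Proof. by move=> a A B; apply/matrixP => i j; rewrite !mxE; ring. Qed.
HB.instance Definition _ := GRing.isLinear.Build _ _ _ _ trmx_sub trmx_sub_linear.

Definition trmx_add (A : 'M[K]_n) : 'M[K]_n := A^T + A.
Fact trmx_add_linear : linear trmx_add.
Proof. by move=> a A B; apply/matrixP => i j; rewrite !mxE; ring. Qed.
HB.instance Definition _ := GRing.isLinear.Build _ _ _ _ trmx_add trmx_add_linear.

Definition diag_row (A : 'M[K]_n) : 'rV[K]_n := \row_i A i i.
Fact diag_row_linear : linear diag_row.
Proof. by move=> a A B; apply/rowP => i; rewrite !mxE. Qed.
HB.instance Definition _ := GRing.isLinear.Build _ _ _ _ diag_row diag_row_linear.

Definition flip_upper (A : 'M[K]_n) : 'M[K]_n :=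
  \matrix_(i, j) ((if (i < j)%N then -1 else 1) * A i j).
Fact flip_upper_linear : linear flip_upper.
Proof. by move=> a A B; apply/matrixP => i j; rewrite !mxE; ring. Qed.
HB.instance Definition _ :=
  GRing.isLinear.Build _ _ _ _ flip_upper flip_upper_linear.

Definition symv : {vspace 'M[K]_n} := lker (linfun trmx_sub).
Definition skewv : {vspace 'M[K]_n} := lker (linfun trmx_add).

Lemma symvP (A : 'M[K]_n) : reflect (A^T = A) (A \in symv).
Proof. by rewrite memv_ker lfunE subr_eq0; exact: eqP. Qed.

Lemma skewvP (A : 'M[K]_n) : reflect (A^T = - A) (A \in skewv).
Proof. by rewrite memv_ker lfunE /= /trmx_add addr_eq0; exact: eqP. Qed.

(** As 2 is invertible, halving [A + A^T] and [A - A^T] gives a direct sum decomposition of the full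
    matrix space. *)
Lemma dim_symv_skewv : (\dim symv + \dim skewv = n * n)%N.
Proof.
have f2 (A : 'M[K]_n) : 2^-1 *: (A + A) = A.
  by apply/matrixP => i j; rewrite !mxE; field.
rewrite -dimv_disjoint_sum.
  rewrite (_ : (_ + _)%VS = fullv) ?dim_fullmx//; apply/vspaceP => A.
  rewrite memvf; apply/memv_addP; exists (2^-1 *: (A + A^T)).
    by apply/symvP; rewrite linearZ linearD /= trmxK addrC.
  exists (2^-1 *: (A - A^T)).
    by apply/skewvP; rewrite linearZ linearB /= trmxK -scalerN opprB.
  by rewrite -scalerDr addrACA subrr addr0 f2.
apply/vspaceP => A; rewrite memv_cap memv0;
apply/andP/eqP => [[]|->]; last by rewrite !mem0v.
move=> /symvP sA /skewvP; rewrite sA => AN.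
by rewrite -[A]f2 {2}AN subrr scaler0.
Qed.

(* Flipping the sign above the diagonal exchanges symmetric matrices with zero
   diagonal and skew-symmetric ones. *)
Lemma dim_symv_diag : (\dim symv = \dim skewv + n)%N.
Proof.
rewrite (@dim_onto _ _ _ diag_row symv fullv); last 2 first.
- by move=> *; exact: memvf.
- move=> w _; exists (diag_mx w); first by apply/symvP; rewrite tr_diag_mx.
  by apply/rowP => i; rewrite !mxE eqxx.
rewrite dim_fullmx mul1n; congr (_ + _)%N.
have memP (A : 'M[K]_n) : (A \in (symv :&: lker (linfun diag_row))%VS) <->
    (A^T = A /\ forall i, A i i = 0).
  rewrite memv_cap memv_ker lfunE /=; split=> [/andP[/symvP sA /eqP/rowP dA]|[sA dA]].
    by split=> // i; move: (dA i); rewrite !mxE.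
  by apply/andP; split; [exact/symvP|apply/eqP/rowP => i; rewrite !mxE].
have flipK : involutive flip_upper.
  by move=> A; apply/matrixP => i j; rewrite !mxE; case: ifP => _; ring.
apply: (@dim_injective_onto _ _ _ flip_upper).
- move=> A /memP[/matrixP sA dA]; apply/skewvP/matrixP => i j; rewrite !mxE.
  move: (sA i j); rewrite mxE => ->.
  by case: ltngtP => [_|_|/val_inj ->]; rewrite ?dA; ring.
- by move=> A _ A0; rewrite -[A]flipK A0 linear0.
move=> A /skewvP/matrixP sA; exists (flip_upper A); last exact: flipK.
have dA i : A i i = 0.
  have := sA i i; rewrite !mxE => /eqP; rewrite -addr_eq0 -mulr2n mulrn_eq0 /=.
  by move/eqP.
apply/memP; split=> [|i]; last by rewrite mxE dA mulr0.
apply/matrixP => i j; have := sA i j; rewrite !mxE => ->.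
by case: ltngtP => [_|_|/val_inj ->]; rewrite ?dA; ring.
Qed.

(** The two preceding relations give twice the dimension as [n * n - n]; this product of consecutive
    integers is even, so halving is exact. *)
Lemma dim_skewv : \dim skewv = (n * n.-1)./2.
Proof.
have := dim_symv_skewv; rewrite dim_symv_diag => h.
by apply/double_inj; rewrite even_halfK; [nia|rewrite oddM; case: (n) => //= m; rewrite andNb].
Qed.

End RealSymmetric.

Lemma dim_pair (K : fieldType) (aT bT : vectType K) (U : {vspace (aT * bT)%type})
    (V : {vspace aT}) (W : {vspace bT}) :
  (forall X, X \in U <-> X.1 \in V /\ X.2 \in W) -> \dim U = (\dim V + \dim W)%N.
Proof.
move=> memU; rewrite (@dim_onto _ _ _ (@fst aT bT) U V); last 2 first.
- by move=> x /memU[].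
- by move=> v vV; exists (v, 0) => //; apply/memU; rewrite mem0v.
rewrite addnC; congr (_ + _)%N.
apply: (@dim_injective_onto _ _ _ (@snd aT bT)).
- by move=> x; rewrite memv_cap => /andP[/memU[]].
- move=> [x y]; rewrite memv_cap memv_ker lfunE /= => /andP[_ /eqP /= ->] -> //.
- move=> w wW; exists (0, w) => //; rewrite memv_cap memv_ker lfunE /= eqxx andbT.
  by apply/memU; rewrite mem0v.
Qed.

(** * Adjoints and real coordinates over both scalar fields *)

Section ScalarField.
Variables (R : realType) (k : scalar_kind).
Local Notation F := (scalarF R k).

Fact scalar_conj_nmod_morphism : nmod_morphism (@scalar_conj R k).
Proof.
by rewrite /scalar_conj; case: k; split=> //; [exact: conjc0|exact: (rmorphD conjc)].
Qed.
Fact scalar_conj_monoid_morphism : monoid_morphism (@scalar_conj R k).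
Proof.
by rewrite /scalar_conj; case: k; split=> //; [exact: conjc1|exact: (rmorphM conjc)].
Qed.
HB.instance Definition _ := GRing.isNmodMorphism.Build F F (@scalar_conj R k)
  scalar_conj_nmod_morphism.
HB.instance Definition _ := GRing.isMonoidMorphism.Build F F (@scalar_conj R k)
  scalar_conj_monoid_morphism.

Lemma scalar_conjK : involutive (@scalar_conj R k).
Proof. by rewrite /scalar_conj; case: k => // x; exact: conjcK. Qed.

Lemma scalar_conj_gt0 (x : F) : 0 < x -> scalar_conj x = x.
Proof.
move: x; rewrite /scalar_conj; case: k => //= x /gtr0_real x_real.
by rewrite -(RRe_real x_real) conjc_real.
Qed.

(* For real scalars the imaginary part is discarded, so [of_reim] below is only a
   left inverse of [reim]. *)
Definition scalar_pair (x y : R) : F :=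
  match k return scalarF R k with
  | RealScalars => x
  | ComplexScalars => (x +i* y)%C
  end.

Lemma adjmxK m n : cancel (@adjmx R k m n) (@adjmx R k n m).
Proof. by move=> A; apply/matrixP => i j; rewrite !mxE scalar_conjK. Qed.

Lemma adjmxM m n p (A : 'M[F]_(m, n)) (B : 'M[F]_(n, p)) :
  adjmx (A *m B) = adjmx B *m adjmx A.
Proof. by rewrite /adjmx map_mxM trmx_mul. Qed.

Lemma adjmxD m n (A B : 'M[F]_(m, n)) : adjmx (A + B) = adjmx A + adjmx B.
Proof. by rewrite /adjmx map_mxD linearD. Qed.

Lemma adjmx0 m n : adjmx (0 : 'M[F]_(m, n)) = 0.
Proof. by rewrite /adjmx map_mx0 trmx0. Qed.

Lemma adjmxZ m n (a : F) (A : 'M[F]_(m, n)) :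
  adjmx (a *: A) = scalar_conj a *: adjmx A.
Proof. by rewrite /adjmx map_mxZ linearZ. Qed.

(** A version of [realify] for rectangular matrices, as [D A V] need not be square. *)
Definition reim m n (A : 'M[F]_(m, n)) : 'M[R]_(m, n) * 'M[R]_(m, n) :=
  (map_mx (@scalar_Re R k) A, map_mx (@scalar_Im R k) A).

Definition of_reim m n (X : 'M[R]_(m, n) * 'M[R]_(m, n)) : 'M[F]_(m, n) :=
  \matrix_(i, j) scalar_pair (X.1 i j) (X.2 i j).

Lemma reimK m n : cancel (@reim m n) (@of_reim m n).
Proof.
move=> A; apply/matrixP => i j; rewrite !mxE; move: (A i j).
by rewrite /scalar_pair /scalar_Re /scalar_Im; case: k => //= -[].
Qed.

Lemma reimD m n (A B : 'M[F]_(m, n)) : reim (A + B) = reim A + reim B.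
Proof.
congr (_, _); apply/matrixP => i j; rewrite !mxE.
  by move: (A i j) (B i j); rewrite /scalar_Re; case: k => //= -[? ?] [? ?].
move: (A i j) (B i j); rewrite /scalar_Im; case: k => //= [? ?|[? ?] [? ?]//].
by rewrite addr0.
Qed.

Lemma of_reimD m n (X Y : 'M[R]_(m, n) * 'M[R]_(m, n)) :
  of_reim (X + Y) = of_reim X + of_reim Y.
Proof. by apply/matrixP => i j; rewrite !mxE /scalar_pair; case: k. Qed.

Lemma reimZ m n (a : R) (A : 'M[F]_(m, n)) :
  reim (scalar_pair a 0 *: A) = a *: reim A.
Proof.
congr (_, _); apply/matrixP => i j; rewrite !mxE; move: (A i j).
  by rewrite /scalar_Re /scalar_pair; case: k => //= -[x y] /=; ring.
by rewrite /scalar_Im /scalar_pair; case: k => /= [x|[x y]] /=; ring.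
Qed.

Lemma reim0 m n : reim (0 : 'M[F]_(m, n)) = 0.
Proof. by rewrite -[in LHS](scaler0 _ (scalar_pair 0 0)) reimZ scale0r. Qed.

Lemma of_reimZ m n (a : R) (X : 'M[R]_(m, n) * 'M[R]_(m, n)) :
  of_reim (a *: X) = scalar_pair a 0 *: of_reim X.
Proof.
apply/matrixP => i j; rewrite !mxE /scalar_pair; case: k => //=.
by apply/eqP; rewrite eq_complex /=; apply/andP; split; apply/eqP; ring.
Qed.

Lemma scalar_conj_pair a : scalar_conj (scalar_pair a 0) = scalar_pair a 0.
Proof. by rewrite /scalar_conj /scalar_pair; case: k => //; exact: conjc_real. Qed.

(** The map sending [A] to [D A V], read in real coordinates so that its kernel is a real
    subspace. *)
Definition reim_mul m n r p (D : 'M[F]_(r, m)) (V : 'M[F]_(n, p))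
    (X : 'M[R]_(m, n) * 'M[R]_(m, n)) : 'M[R]_(r, p) * 'M[R]_(r, p) :=
  reim (D *m of_reim X *m V).
Fact reim_mul_linear m n r p (D : 'M[F]_(r, m)) (V : 'M[F]_(n, p)) :
  linear (reim_mul D V).
Proof.
move=> a X Y; rewrite /reim_mul of_reimD of_reimZ mulmxDr mulmxDl.
by rewrite -scalemxAr -scalemxAl reimD reimZ.
Qed.
HB.instance Definition _ m n r p (D : 'M[F]_(r, m)) (V : 'M[F]_(n, p)) :=
  GRing.isLinear.Build _ _ _ _ (reim_mul D V) (reim_mul_linear D V).

(** Subtracting [X] itself, and not [reim (of_reim X)], makes the kernel lie in the image of [reim]:
    for real scalars a vanishing defect also forces the second component to be 0. *)
Definition herm_defect n (X : 'M[R]_n * 'M[R]_n) : 'M[R]_n * 'M[R]_n :=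
  reim (adjmx (of_reim X)) - X.
Fact herm_defect_linear n : linear (@herm_defect n).
Proof.
move=> a X Y; rewrite /herm_defect of_reimD of_reimZ adjmxD adjmxZ.
by rewrite scalar_conj_pair reimD reimZ scalerBr opprD addrACA.
Qed.
HB.instance Definition _ n :=
  GRing.isLinear.Build _ _ _ _ (@herm_defect n) (@herm_defect_linear n).

(** The kernel is the image of [reim]: everything for complex scalars, the pairs with zero second
    component for real ones. *)
Definition real_defect m n (X : 'M[R]_(m, n) * 'M[R]_(m, n)) :
  'M[R]_(m, n) * 'M[R]_(m, n) := reim (of_reim X) - X.
Fact real_defect_linear m n : linear (@real_defect m n).
Proof.
move=> a X Y; rewrite /real_defect of_reimD of_reimZ reimD reimZ.
by rewrite scalerBr opprD addrACA.
Qed.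
HB.instance Definition _ m n :=
  GRing.isLinear.Build _ _ _ _ (@real_defect m n) (@real_defect_linear m n).

Definition reimv m n : {vspace ('M[R]_(m, n) * 'M[R]_(m, n))%type} :=
  lker (linfun (@real_defect m n)).
Definition hermv n : {vspace ('M[R]_n * 'M[R]_n)%type} :=
  lker (linfun (@herm_defect n)).

Lemma reimvP m n X : reflect (exists A : 'M[F]_(m, n), X = reim A) (X \in reimv m n).
Proof.
rewrite memv_ker lfunE subr_eq0; apply: (iffP eqP) => [<-|[A ->]]; first by eexists.
by rewrite reimK.
Qed.

Lemma hermvP n X :
  reflect (exists2 A : 'M[F]_n, adjmx A = A & X = reim A) (X \in hermv n).
Proof.
rewrite memv_ker lfunE subr_eq0; apply: (iffP eqP) => [h|[A hA ->]]; last first.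
  by rewrite reimK hA.
exists (of_reim X); last by rewrite -[in RHS]h reimK h.
by rewrite -[in RHS]h reimK.
Qed.

Lemma dim_reimv m n : \dim (reimv m n) = (alpha k * (m * n))%N.
Proof.
pose W : {vspace 'M[R]_(m, n)} := if k is RealScalars then 0%VS else fullv.
rewrite (@dim_pair _ _ _ _ fullv W) => [|X].
  by rewrite dim_fullmx /W; case: k; rewrite ?dimv0 ?dim_fullmx /=; lia.
rewrite memvf; split=> [/reimvP[A ->]|[_ XW]]; last first.
  apply/reimvP; exists (of_reim X); move: XW; rewrite /W; case: X => X Y.
  rewrite /reim /of_reim /scalar_Re /scalar_Im /scalar_pair /=.
  case: k => [|_]; rewrite ?memv0.
    by move=> /eqP ->; congr (_, _); apply/matrixP => i j; rewrite !mxE.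
  by congr (_, _); apply/matrixP => i j; rewrite !mxE.
split=> //; rewrite /W /reim /= /scalar_Im; move: A; case: k => A; last exact: memvf.
by rewrite memv0; apply/eqP/matrixP => i j; rewrite !mxE.
Qed.

(** A Hermitian matrix has symmetric real part and skew-symmetric imaginary part, the latter being 0
    for real scalars. *)
Lemma dim_hermv n : \dim (hermv n) = dim_Sym k n.
Proof.
pose W : {vspace 'M[R]_n} := if k is RealScalars then 0%VS else skewv R n.
rewrite (@dim_pair _ _ _ _ (symv R n) W) => [|X].
  rewrite dim_symv_diag /dim_Sym /W; case: k; rewrite ?dimv0 ?dim_skewv /=; lia.
have memW : X \in hermv n <-> reim (adjmx (of_reim X)) = X.
  by rewrite memv_ker lfunE subr_eq0; split=> /eqP.
rewrite memW; case: X {memW} => X Y.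
have -> : reim (adjmx (of_reim (X, Y))) = (X^T, if k is RealScalars then 0 else - Y^T).
  rewrite /reim /adjmx /of_reim /scalar_Re /scalar_Im /scalar_pair /scalar_conj.
  by case: k; congr (_, _); apply/matrixP => i j; rewrite !mxE.
rewrite /W; case: k => /=.
  split=> [[sX <-]|[/symvP -> ]]; first by rewrite mem0v; split=> //; exact/symvP.
  by rewrite memv0 => /eqP ->.
split=> [[sX sY]|[/symvP -> /skewvP ->]]; last by rewrite opprK.
by split; [exact/symvP|apply/skewvP; rewrite -[in RHS]sY opprK].
Qed.

End ScalarField.

(** * Subspaces of column vectors *)

Section Columns.
Variable K : fieldType.

Lemma memv_limg_mulmx n m (X : 'M[K]_(n, m)) (x : 'cV[K]_n) :
  x \in limg (linfun (mulmx X : 'cV[K]_m -> 'cV[K]_n)) <-> exists u, x = X *m u.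
Proof.
split=> [/memv_imgP[u _ ->]|[u ->]]; first by exists u; rewrite lfunE.
by apply/memv_imgP; exists u; rewrite ?memvf// lfunE.
Qed.

(** In the rank factorization [col_base X *m row_base X] the right factor is onto and the left one
    injective, so the column space is isomorphic to the space of columns of height [\rank X]. *)
Lemma mxrank_dim_limg n m (X : 'M[K]_(n, m)) :
  \rank X = \dim (limg (linfun (mulmx X : 'cV[K]_m -> 'cV[K]_n))).
Proof.
have [B BX] : exists B, B *m col_base X = 1%:M.
  have /row_freeP[C hC] : row_free (col_base X)^T.
    by rewrite /row_free mxrank_tr; exact: col_base_full.
  by exists C^T; apply/trmx_inj; rewrite trmx_mul trmxK trmx1.
rewrite -[LHS]muln1 -(dim_fullmx K).
apply: (@dim_injective_onto _ _ _
  (mulmx (col_base X) : {linear 'cV[K]_(\rank X) -> 'cV[K]_n})).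
- have /row_freeP[C hC] := row_base_free X.
  move=> u _; apply/memv_limg_mulmx; exists (C *m u).
  have XC : col_base X = X *m C.
    transitivity (col_base X *m row_base X *m C); last by rewrite mulmx_base.
    by rewrite -mulmxA hC mulmx1.
  by rewrite /= mulmxA -XC.
- by move=> u _ /(congr1 (mulmx B)); rewrite mulmxA BX mul1mx mulmx0.
- move=> w /memv_limg_mulmx[u ->]; exists (row_base X *m u); first exact: memvf.
  by rewrite /= mulmxA mulmx_base.
Qed.

Lemma vspace_colmx n (T : {vspace 'cV[K]_n}) :
  exists W : 'M[K]_(n, \dim T), forall x, x \in T <-> exists u, x = W *m u.
Proof.
pose W := \matrix_(i < n, j < \dim T) (vbasis T)`_j i ord0.
have WE (u : 'cV[K]_(\dim T)) : W *m u = \sum_j u j ord0 *: (vbasis T)`_j.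
  apply/colP => i; rewrite !mxE summxE; apply: eq_bigr => j _.
  by rewrite !mxE mulrC.
exists W => x; split=> [xT|[u ->]].
  exists (\col_j coord (vbasis T) j x); rewrite WE {1}(coord_vbasis xT).
  by apply: eq_bigr => j _; rewrite mxE.
rewrite WE; apply: memv_suml => j _; rewrite memvZ// vbasis_mem// mem_nth//.
by rewrite size_tuple.
Qed.

Lemma vspace_annihilator n (T : {vspace 'cV[K]_n}) :
  exists r (D : 'M[K]_(r, n)),
    [/\ row_free D, (\dim T + r)%N = n & forall x, x \in T <-> D *m x = 0].
Proof.
have [W WT] := vspace_colmx T.
(* [cokermx] describes row spaces, hence the transpositions; [row_base] then extracts independent
   forms. *)
pose D0 := (cokermx W^T)^T; exists (\rank D0), (row_base D0).
have TD x : x \in T <-> row_base D0 *m x = 0.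
  have -> : row_base D0 *m x = 0 <-> D0 *m x = 0.
    split=> [h|h]; first by rewrite -(mulmx_base D0) -mulmxA h mulmx0.
    have /submxP[C ->] : (row_base D0 <= D0)%MS by rewrite eq_row_base.
    by rewrite -mulmxA h mulmx0.
  rewrite WT; have -> : D0 *m x = 0 <-> (x^T <= W^T)%MS.
    rewrite submxE; split=> [/(congr1 trmx)|/eqP/(congr1 trmx)].
      by rewrite trmx_mul /D0 trmxK trmx0 => ->.
    by rewrite trmx_mul trmxK trmx0.
  split=> [[u ->]|/submxP[C]]; first by rewrite trmx_mul submxMl.
  by move=> /(congr1 trmx); rewrite trmx_mul !trmxK => ->; exists C^T.
split; [exact: row_base_free| |by []].
(* The right inverse [C] makes the forms jointly onto, so rank-nullity counts them. *)
have /row_freeP[C hC] := row_base_free D0.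
transitivity (\dim {: 'cV[K]_n}); last by rewrite dim_fullmx muln1.
rewrite (@dim_onto _ _ _
  (mulmx (row_base D0) : {linear 'cV[K]_n -> 'cV[K]_(\rank D0)}) fullv fullv).
- rewrite dim_fullmx muln1; congr (\dim _ + _)%N; apply/vspaceP => x.
  rewrite memv_cap memvf memv_ker lfunE /=.
  by apply/idP/eqP => /TD.
- by move=> *; exact: memvf.
- move=> w _; exists (C *m w); first exact: memvf.
  by rewrite /= mulmxA hC mul1mx.
Qed.

(** This turns a rank bound into the invertibility of some [d * d] matrix, a condition whose
    openness is visible on determinants. *)
Lemma rank_geP n m d (X : 'M[K]_(n, m)) :
  (d <= \rank X)%N <->
  exists (G : 'M[K]_(d, n)) (H : 'M[K]_(m, d)), G *m X *m H \in unitmx.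
Proof.
split=> [dX|[G [H GXH]]]; last first.
  rewrite -[leqLHS](mxrank_unit GXH).
  exact: leq_trans (mxrankM_maxl _ _) (mxrankM_maxr _ _).
(* Undo the Gaussian elimination of [X] and keep the leading identity block of size [d]. *)
exists (pid_mx d *m invmx (col_ebase X)), (invmx (row_ebase X) *m pid_mx d).
rewrite -{2}(mulmx_ebase X) -!mulmxA mulKVmx ?row_ebase_unit//.
rewrite mulKmx ?col_ebase_unit// mul_pid_mx mul_pid_mx.
have := rank_leq_row X; have := rank_leq_col X => h1 h2.
by rewrite (_ : minn n _ = d) ?pid_mx_1 ?unitmx1//; lia.
Qed.

End Columns.

(** * Open conditions on matrices *)

Section MatrixContinuity.
Variables (K : numFieldType) (T : topologicalType).

Lemma continuous_cst_mul (a : K) (g : T -> K) :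
  continuous g -> continuous (fun x => a * g x).
Proof. by move=> cg x; exact: (continuous_comp (cg x) (@mulrl_continuous K a (g x))). Qed.

Lemma continuous_mul_cst (a : K) (g : T -> K) :
  continuous g -> continuous (fun x => g x * a).
Proof. by move=> cg x; exact: (continuous_comp (cg x) (@mulrr_continuous K a (g x))). Qed.

Lemma continuous_sumK (I : Type) (r : seq I) (F : I -> T -> K) :
  (forall i, continuous (F i)) -> continuous (fun x => \sum_(i <- r) F i x).
Proof. by move=> cF; apply: continuous_big => //; exact: add_continuous. Qed.

(** The Leibniz formula is polynomial in the entries. Continuity is assumed entrywise, which is how
    it is checked for [of_reim]. *)
Lemma continuous_det n (f : T -> 'M[K]_n) :
  (forall i j, continuous (fun x => f x i j)) -> continuous (fun x => \det (f x)).
Proof.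
move=> cf; apply: continuous_sumK => s; apply: continuous_cst_mul.
by apply: continuous_big => //; exact: mul_continuous.
Qed.

Lemma continuous_mulmx_entry n m p (f : T -> 'M[K]_(n, m)) (B : 'M[K]_(m, p)) :
  (forall i j, continuous (fun x => f x i j)) ->
  forall i j, continuous (fun x => (f x *m B) i j).
Proof.
move=> cf i j; rewrite (_ : (fun x => _) = fun x => \sum_l f x i l * B l j).
  by apply: continuous_sumK => l; exact: continuous_mul_cst.
by apply/funext => x; rewrite mxE.
Qed.

Lemma continuous_mulmx_entryl n m p (A : 'M[K]_(n, m)) (f : T -> 'M[K]_(m, p)) :
  (forall i j, continuous (fun x => f x i j)) ->
  forall i j, continuous (fun x => (A *m f x) i j).
Proof.
move=> cf i j; rewrite (_ : (fun x => _) = fun x => \sum_l A i l * f x l j).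
  by apply: continuous_sumK => l; exact: continuous_cst_mul.
by apply/funext => x; rewrite mxE.
Qed.

Lemma open_unitmx n (f : T -> 'M[K]_n) :
  (forall i j, continuous (fun x => f x i j)) -> open [set x | f x \in unitmx].
Proof.
move=> cf; rewrite (_ : mkset _ = (fun x => \det (f x)) @^-1` (~` [set 0])).
  apply: open_comp => [x _|]; first exact: continuous_det.
  apply: closed_openC; apply: accessible_closed_set1; apply: hausdorff_accessible.
  exact: (@norm_hausdorff K K^o).
apply/seteqP; split=> x /=; rewrite unitmxE unitfE.
  by move=> /negP h e; apply: h; rewrite e.
by move=> h; apply/eqP.
Qed.

Lemma open_rank_ge n m d (f : T -> 'M[K]_(n, m)) :
  (forall i j, continuous (fun x => f x i j)) -> open [set x | (d <= \rank (f x))%N].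
Proof.
move=> cf; rewrite (_ : mkset _ =
    \bigcup_(GH in [set: 'M[K]_(d, n) * 'M[K]_(m, d)])
       [set x | GH.1 *m f x *m GH.2 \in unitmx]).
  apply: bigcup_open => -[G H] _; apply: open_unitmx.
  exact/continuous_mulmx_entry/continuous_mulmx_entryl.
apply/seteqP; split=> x /=.
  by move=> /rank_geP[G [H GH]]; exists (G, H).
by move=> [[G H] _ GH]; apply/rank_geP; exists G, H.
Qed.

Lemma continuous_row_mx_entry n m1 m2 (A : 'M[K]_(n, m1)) (f : T -> 'M[K]_(n, m2)) :
  (forall i j, continuous (fun x => f x i j)) ->
  forall i j, continuous (fun x => row_mx A (f x) i j).
Proof.
move=> cf i j; rewrite (_ : (fun x => _) =
   fun x => match fintype.split j with inl l => A i l | inr l => f x i l end).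
  by case: (fintype.split j) => l; [move=> x; exact: cst_continuous|exact: cf].
by apply/funext => x; rewrite mxE.
Qed.

End MatrixContinuity.

Lemma continuous_scalar_pair (R : realType) (k : scalar_kind) (T : topologicalType)
    (f g : T -> R) : continuous f -> continuous g ->
  continuous (fun x => scalar_pair k (f x) (g x) : scalarF R k).
Proof.
case: k => // cf cg x; apply/(@cvgrPdist_lt _ (R[i] : numFieldType)^o) => e e0.
(* A positive element of [R[i]] is real, so the radius can be halved in [R] and shared between the
   two parts. *)
have ee : e = (complex.Re e)%:C%C by rewrite RRe_real// gtr0_real.
have e20 : 0 < complex.Re e / 2 by rewrite divr_gt0// -ltcR -ee.
have /cvgrPdist_lt/(_ _ e20) nf := cf x.
have /cvgrPdist_lt/(_ _ e20) ng := cg x.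
near=> y; rewrite /scalar_pair.
have -> : (f x +i* g x)%C - (f y +i* g y)%C =
   (f x - f y)%:C%C + 'i%C * (g x - g y)%:C%C :> R[i].
  by apply/eqP; rewrite eq_complex /=; apply/andP; split; apply/eqP; ring.
rewrite (le_lt_trans (ler_normD _ _))// normrM.
have -> : `|'i%C : R[i]| = 1 by rewrite normc_def /= expr0n expr1n add0r sqrtr1.
have nE (a : R) : `|a%:C%C : R[i]| = `|a|%:C%C
  by rewrite normc_def /= expr0n addr0 sqrtr_sqr.
rewrite mul1r !nE -rmorphD ee ltcR (splitr (complex.Re e)) ltrD//.
  by near: y.
by near: y.
Unshelve. all: by end_near.
Qed.

(** * The sets Msym and MsymT *)

(** This keeps the subtraction in [dim_Msym] from being truncated. For [n = r + p] it amounts to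
    [r * r + p * p >= r + p]. *)
Lemma leq_mul_half r p n : (r + p <= n)%N -> (r * p <= (n * n.-1)./2)%N.
Proof.
move=> rpn; rewrite geq_half_double -(subnKC rpn).
move: (n - (r + p))%N => e; case: r p {rpn} => [|r] [|p] /=; nia.
Qed.

Section MsymStructure.
Variables (R : realType) (k : scalar_kind) (n : nat).
Local Notation F := (scalarF R k).
Variables (S S' : {vspace 'cV[F]_n}) (p : nat) (V : 'M[F]_(n, p)).
Hypotheses (hSS' : (S <= S')%VS) (hV : orthonormal_basis_mx S V).

Lemma basis_memP x : x \in S <-> exists u, x = V *m u.
Proof. by rewrite -hV.2; exact: memv_limg_mulmx. Qed.

(** [V *m adjmx V] is the orthogonal projection onto [S]. *)
Lemma basis_projK x : x \in S -> V *m (adjmx V *m x) = x.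
Proof. by move=> /basis_memP[u ->]; rewrite (mulmxA (adjmx V)) hV.1 mul1mx. Qed.

Lemma basis_projK_mx m (W : 'M[F]_(n, m)) :
  (forall u : 'cV_m, W *m u \in S) -> V *m (adjmx V *m W) = W.
Proof.
move=> WS; apply/matrixP => i j.
have /colP/(_ i) := basis_projK (WS (delta_mx j 0)).
by rewrite !mulmxA -!colE !mxE.
Qed.

Lemma span_sum_limg (A : 'M[F]_n) :
  (S + linfun (mulmx A) @: S)%VS =
  limg (linfun (mulmx (row_mx V (A *m V)) : 'cV[F]_(p + p) -> 'cV[F]_n)).
Proof.
apply/vspaceP => x; apply/memv_addP/idP => [[s sS [_ /memv_imgP[t tS ->] ->]]|].
  have [[u ->] [v ->]] := ((basis_memP s).1 sS, (basis_memP t).1 tS).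
  apply/memv_limg_mulmx; exists (col_mx u v).
  by rewrite mul_row_col lfunE /= mulmxA.
move=> /memv_limg_mulmx[w ->]; rewrite -[w]vsubmxK mul_row_col.
exists (V *m usubmx w); first by apply/basis_memP; eexists.
exists (A *m (V *m dsubmx w)); last by rewrite mulmxA.
apply/memv_imgP; exists (V *m dsubmx w); last by rewrite lfunE.
by apply/basis_memP; eexists.
Qed.

Lemma Msym_rankP r (D : 'M[F]_(r, n)) (A : 'M[F]_n) :
  (forall x, x \in S' <-> D *m x = 0) ->
  Msym S S' A <->
  [/\ SymF A, D *m A *m V = 0 & (\dim S' <= \rank (row_mx V (A *m V)))%N].
Proof.
move=> hD; rewrite mxrank_dim_limg -span_sum_limg; split=> [[sA SA]|[sA DAV dimA]].
  rewrite SA; split=> //; apply/matrixP => i j.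
  have : A *m (V *m delta_mx j 0) \in (S + linfun (mulmx A) @: S)%VS.
    apply: (subvP (addvSr _ _)); apply/memv_imgP.
    by exists (V *m delta_mx j 0); [apply/basis_memP; eexists|rewrite lfunE].
  by rewrite SA => /hD /colP/(_ i); rewrite !mulmxA -colE !mxE.
split=> //; apply/eqP; rewrite eqEdim dimA andbT subv_add hSS' /=.
apply/subvP => _ /memv_imgP[s sS ->]; rewrite lfunE /=; apply/hD.
by have /basis_memP[u ->] := sS; rewrite !mulmxA DAV mul0mx.
Qed.

(** On [S] the shift changes the value of [A] by an element of [S], which the sum with [S] absorbs.
    Reality of [t] keeps the matrix Hermitian. *)
Lemma shift_Msym (A : 'M[F]_n) (t : F) : scalar_conj t = t ->
  Msym S S' A -> Msym S S' (A + t *: (V *m adjmx V)).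
Proof.
move=> ct [sA SA]; split.
  by rewrite /SymF /= adjmxD adjmxZ adjmxM adjmxK ct sA.
rewrite -[RHS]SA; apply/eqP; rewrite eqEsubv !subv_add !addvSl /=.
have VS u : V *m u \in S by apply/basis_memP; exists u.
apply/andP; split; apply/subvP => _ /memv_imgP[s sS ->]; rewrite lfunE /=.
  rewrite mulmxDl addrC memv_add//; last by apply/memv_imgP; exists s; rewrite ?lfunE.
  by rewrite -scalemxAl memvZ// -mulmxA.
rewrite (_ : A *m s = - (t *: (V *m (adjmx V *m s))) + (A + t *: (V *m adjmx V)) *m s).
  rewrite memv_add//; first by rewrite memvN memvZ.
  by apply/memv_imgP; exists s; rewrite ?lfunE.
by rewrite mulmxDl -scalemxAl mulmxA addrCA addNr addr0.
Qed.

(** Here [W = V Q] with [Q = adjmx V *m W] invertible, so the two compressions of [A] are congruent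
    through [Q]. *)
Lemma MsymT_indep (W : 'M[F]_(n, p)) :
  orthonormal_basis_mx S W -> MsymT S S' W = MsymT S S' V.
Proof.
move=> hW.
have WV : V *m (adjmx V *m W) = W.
  apply: basis_projK_mx => u; rewrite -hW.2; apply/memv_limg_mulmx; by eexists.
have unitVW : adjmx V *m W \in unitmx.
  suff : (adjmx W *m V) *m (adjmx V *m W) = 1%:M by case/mulmx1_unit.
  by rewrite -mulmxA WV hW.1.
have unitWV : adjmx W *m V \in unitmx.
  suff : (adjmx W *m V) *m (adjmx V *m W) = 1%:M by case/mulmx1_unit.
  by rewrite -mulmxA WV hW.1.
have unitE A : (adjmx W *m A *m W \in unitmx) = (adjmx V *m A *m V \in unitmx).
  rewrite -{2}WV; have -> : adjmx W = adjmx W *m V *m adjmx V.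
    by rewrite -{1}WV !adjmxM adjmxK.
  rewrite -!mulmxA (mulmxA (adjmx W)) unitmx_mul unitWV !mulmxA /=.
  by rewrite -[in LHS]mulmxA unitmx_mul unitVW andbT.
by apply/seteqP; split=> A [MA uA]; split=> //; move: uA; rewrite /= unitE.
Qed.

Lemma reim_Msym r (D : 'M[F]_(r, n)) :
  (forall x, x \in S' <-> D *m x = 0) ->
  realify (n := n) @` Msym S S' =
  [set` (hermv R k n :&: lker (linfun (reim_mul D V)))%VS] `&`
  [set X | (\dim S' <= \rank (row_mx V (of_reim k X *m V)))%N].
Proof.
move=> hD; apply/seteqP; split=> [_ [A /(Msym_rankP _ hD)[sA DA rA] <-]|X /=].
  split=> /=; last by rewrite (reimK A).
  rewrite memv_cap; apply/andP; split; first by apply/hermvP; exists A.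
  by rewrite memv_ker lfunE /= /reim_mul (reimK A) DA reim0.
rewrite memv_cap memv_ker lfunE /= => -[/andP[/hermvP[A sA ->]]].
rewrite /reim_mul reimK -(reim0 R k) => /eqP /(can_inj (@reimK R k r p)) DA rA.
by exists A => //; apply/(Msym_rankP _ hD).
Qed.

Lemma dim_reim_Msym r (D : 'M[F]_(r, n)) : row_free D -> D *m V = 0 ->
  (\dim (hermv R k n :&: lker (linfun (reim_mul D V))) + alpha k * (r * p))%N =
  dim_Sym k n.
Proof.
move=> /row_freeP[B DB] DV; rewrite -(dim_hermv R) -(dim_reimv R).
symmetry; apply: dim_onto => [X _|_ /reimvP[M ->]].
  by apply/reimvP; eexists.
(* [B] is a right inverse of [D], so [D C V = M], while [D V = 0] kills the contribution of
   [adjmx C]. *)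
pose C := B *m M *m adjmx V; exists (reim (C + adjmx C)).
  by apply/hermvP; exists (C + adjmx C); rewrite // adjmxD adjmxK addrC.
rewrite /= /reim_mul reimK mulmxDr mulmxDl /C.
rewrite !adjmxM adjmxK (mulmxA D V) DV mul0mx mul0mx addr0.
by rewrite !mulmxA DB mul1mx -mulmxA hV.1 mulmx1.
Qed.

Lemma exists_MsymT (hdim : (\dim S' - \dim S <= p)%N) : MsymT S S' V !=set0.
Proof.
have [W0 hW0] := vspace_colmx (S' :\: S)%VS.
set q := \dim (S' :\: S) in W0 hW0.
have qp : (q <= p)%N.
  by have := dimv_cap_compl S' S; rewrite (capv_idPr hSS') -/q; lia.
(* Remove from the columns of [W0] their orthogonal projection onto [S]. *)
pose W := W0 - V *m (adjmx V *m W0).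
have VW : adjmx V *m W = 0.
  by rewrite mulmxBr (mulmxA (adjmx V)) hV.1 mul1mx subrr.
have WV : adjmx W *m V = 0 by rewrite -[V]adjmxK -adjmxM VW adjmx0.
pose J : 'M[F]_(q, p) := pid_mx q.
have JJ : J *m pid_mx q = 1%:M :> 'M[F]_q by rewrite pid_mx_id// pid_mx_1.
pose T := W *m J *m adjmx V.
pose A := V *m adjmx V + (T + adjmx T).
(* Since [adjmx V *m W = 0], this makes the compression of [A] to [S] the identity. *)
have AV : A *m V = V + W *m J.
  rewrite /A 2!mulmxDl -[V *m _ *m V]mulmxA hV.1 mulmx1; congr (_ + _).
  rewrite /T -[_ *m adjmx V *m V]mulmxA hV.1 mulmx1 !adjmxM adjmxK.
  by rewrite -!mulmxA WV !mulmx0 addr0.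
have VS u : V *m u \in S by apply/basis_memP; exists u.
have WS' u : W *m u \in S'.
  rewrite mulmxBl -!mulmxA memvB//; last exact: (subvP hSS').
  by apply: (subvP (diffvSl S' S)); apply/hW0; exists u.
exists A; split; last first.
  by rewrite /= -mulmxA AV mulmxDr hV.1 mulmxA VW mul0mx addr0 unitmx1.
split.
  by rewrite /SymF /= /A !adjmxD adjmxM !adjmxK [adjmx T + T]addrC.
apply/eqP; rewrite eqEsubv subv_add hSS' /=; apply/andP; split.
  apply/subvP => _ /memv_imgP[s /basis_memP[u ->] ->]; rewrite lfunE /= mulmxA AV.
  by rewrite mulmxDl -mulmxA memvD ?WS'// (subvP hSS').
apply: (subv_trans (addvSl S' S)); rewrite -addv_diff subv_add.
apply/andP; split; last exact: addvSl.
apply/subvP => _ /hW0[c ->].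
(* As [pid_mx q] is a right inverse of [J], applying [A] to [V *m (pid_mx q *m c)] yields [W *m c]
   up to an element of [S]. *)
have -> : W0 *m c =
    V *m (adjmx V *m W0 *m c - pid_mx q *m c) + A *m (V *m (pid_mx q *m c)).
  rewrite mulmxA AV mulmxDl -(mulmxA W) (mulmxA J) JJ mul1mx.
  by rewrite mulmxBr addrA subrK mulmxBl !mulmxA addrC subrK.
by rewrite memv_add//; apply/memv_imgP; exists (V *m (pid_mx q *m c)); rewrite ?lfunE.
Qed.

Lemma dense_MsymT : dense_in (Msym S S') (MsymT S S' V).
Proof.
split=> [A []//|A MA B nB].
have cZ : continuous (fun t : F => t *: (V *m adjmx V)).
  by apply: continuous_scaler => t; exact: cvg_id.
have c0 : A + t *: (V *m adjmx V) @[t --> (0 : F)] --> A.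
  by have := cvgD (cvg_cst A) (cZ 0); rewrite scale0r addr0; apply.
have /nbhs_ballP[e /= e0 eB] := c0 _ nB.
(* These are [p + 1] distinct positive shifts below the radius [e], one more than the degree of the
   characteristic polynomial of [M], so one of them is not a root. The offset 2 makes each strictly
   smaller than [e]. *)
pose t (i : 'I_p.+1) : F := e / i.+2%:R.
have t0 i : 0 < t i by rewrite divr_gt0.
have tinj : injective t.
  move=> i j /(mulfI (lt0r_neq0 e0)) /invr_inj /eqP; rewrite eqr_nat => /eqP[].
  exact: val_inj.
pose M := - (adjmx V *m A *m V).
have [i Mi] : exists i, ~~ root (char_poly M) (t i).
  apply/existsP; apply: contraT; rewrite negb_exists => /forallP h.
  have := @max_poly_roots _ (char_poly M) (map t (enum 'I_p.+1)).
  rewrite -size_poly_eq0 size_char_poly size_map size_enum_ord ltnn; apply=> //.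
    by apply/allP => _ /mapP[i _ ->]; rewrite -[root _ _]negbK h.
  by rewrite map_inj_uniq ?enum_uniq.
exists (A + t i *: (V *m adjmx V)); split; last first.
  apply: eB; rewrite /ball /= sub0r normrN gtr0_norm// ltr_pdivrMr// -[ltLHS]mulr1.
  by rewrite ltr_pM2l// ltr1n.
split; first by apply: shift_Msym => //; exact: scalar_conj_gt0.
(* Not being an eigenvalue of [M] makes [M - t I] invertible; its opposite is the compression of the
   shifted matrix. *)
move: Mi; rewrite -eigenvalue_root_char negbK kermx_eq0 row_free_unit.
rewrite -(unitmxZ _ (unitrN1 _)) scaleN1r => uM.
rewrite /= mulmxDr mulmxDl -scalemxAr -scalemxAl.
rewrite !mulmxA hV.1 mul1mx hV.1 scalemx1.
by rewrite /M opprB opprK addrC in uM.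
Qed.

Lemma open_MsymT : open_in (Msym S S') (MsymT S S' V).
Proof.
exists [set A | adjmx V *m A *m V \in unitmx]; last first.
  by apply/seteqP; split=> A [].
apply: open_unitmx; apply: continuous_mulmx_entry; apply: continuous_mulmx_entryl.
by move=> i j; exact: coord_continuous.
Qed.

Lemma embedded_Msym :
  embedded_submanifold (realify (n := n) @` @SymF R k n) (dim_Sym k n)
    (realify (n := n) @` Msym S S') (dim_Msym k n p (\dim S' - \dim S)) /\
  embedded_submanifold (realify (n := n) @` Msym S S')
    (dim_Msym k n p (\dim S' - \dim S))
    (realify (n := n) @` MsymT S S' V) (dim_Msym k n p (\dim S' - \dim S)).
Proof.
have [r [D [Dfree Ddim hD]]] := vspace_annihilator S'.
have DV : D *m V = 0.
  apply/matrixP => i j; have /(subvP hSS')/hD/colP/(_ i) : V *m delta_mx j 0 \in S.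
    by apply/basis_memP; eexists.
  by rewrite mulmxA -colE !mxE.
(* [adjmx V] is a left inverse of [V], so [V] has full column rank. *)
have pS : p = \dim S.
  rewrite -hV.2 -mxrank_dim_limg; apply/esym/eqP.
  have : row_free (V^T).
    apply/row_freeP; exists (adjmx V)^T.
    by rewrite -trmx_mul hV.1 trmx1.
  by rewrite /row_free mxrank_tr.
have [r_eq rp_n] : r = (n - p - (\dim S' - \dim S))%N /\ (r + p <= n)%N.
  by move: Ddim pS (dimvS hSS'); set d := \dim S; set d' := \dim S'; lia.
set L := (hermv R k n :&: lker (linfun (reim_mul D V)))%VS.
have dimL : \dim L = dim_Msym k n p (\dim S' - \dim S).
  have := dim_reim_Msym Dfree DV; rewrite /dim_Msym -r_eq /dim_Sym -/L => dL.
  have rp := leq_mul_half rp_n.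
  move: dL; rewrite mulnBr [(r * p)%N]mulnC.
  have : (alpha k * (p * r) <= alpha k * (n * n.-1)./2)%N
    by rewrite leq_mul2l mulnC rp orbT.
  lia.
pose O1 := [set X | (\dim S' <= \rank (row_mx V (of_reim k X *m V)))%N].
pose O2 := [set X | adjmx V *m of_reim k X *m V \in unitmx].
have cof (i j : 'I_n) : continuous (fun X : 'M[R]_n * 'M[R]_n => of_reim k X i j).
  rewrite (_ : (fun X => _) = fun X : 'M[R]_n * 'M[R]_n =>
      scalar_pair k (X.1 i j) (X.2 i j)); last by apply/funext => X; rewrite mxE.
  apply: continuous_scalar_pair => X.
    exact: (continuous_comp (@cvg_fst _ _ _ _ _) (@coord_continuous R n n i j X.1)).
  exact: (continuous_comp (@cvg_snd _ _ _ _ _) (@coord_continuous R n n i j X.2)).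
have oO1 : open O1.
  apply: open_rank_ge; apply: continuous_row_mx_entry.
  exact: continuous_mulmx_entry.
have oO2 : open O2.
  by apply: open_unitmx; apply: continuous_mulmx_entry; exact: continuous_mulmx_entryl.
have symE : realify (n := n) @` @SymF R k n = [set` hermv R k n] `&` setT.
  rewrite setIT; apply/seteqP; split=> [_ [A sA <-]|X /= /hermvP[A sA ->]].
    by apply/hermvP; exists A.
  by exists A.
have symTE : realify (n := n) @` MsymT S S' V = [set` L] `&` (O1 `&` O2).
  rewrite setIA -(reim_Msym hD); apply/seteqP; split=> [_ [A [MA uA] <-]|_ [[A MA <-]]].
    by split; [exists A|rewrite /O2 /= (reimK A)].
  by rewrite /O2 /= (reimK A) => uA; exists A.
(* The first claim compares [L] with all Hermitian matrices, taking the larger open set to be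
   everything. In the second, both subspaces are [L] and only the open set shrinks, hence equal
   dimensions. *)
split.
  rewrite symE (reim_Msym hD); apply: embedded_open_in_subspaces => //.
    exact: capvSl.
  exact: dim_hermv.
rewrite symTE (reim_Msym hD); apply: embedded_open_in_subspaces => //.
exact: openI.
Qed.

End MsymStructure.

Theorem lemma5p13 (R : realType) (k : scalar_kind) (n : nat)
    (S S' : {vspace 'cV[scalarF R k]_n}) (p q : nat)
    (V : 'M[scalarF R k]_(n, p))
    (hn : (1 <= n)%N)
    (hSS' : (S <= S')%VS)
    (hp : p = \dim S) (hp1 : (1 <= p)%N)
    (hq : q = (\dim S' - \dim S)%N) (hqp : (q <= p)%N)
    (hV : orthonormal_basis_mx S V) :
  (* (i) *)
  (MsymT S S' V !=set0 /\
   forall W : 'M[scalarF R k]_(n, p),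
     orthonormal_basis_mx S W -> MsymT S S' W = MsymT S S' V) /\
  (* (ii) *)
  (open_in (Msym S S') (MsymT S S' V) /\
   dense_in (Msym S S') (MsymT S S' V)) /\
  (* (iii) *)
  (embedded_submanifold
     (realify (n := n) @` @SymF R k n) (dim_Sym k n)
     (realify (n := n) @` Msym S S') (dim_Msym k n p q) /\
   embedded_submanifold
     (realify (n := n) @` Msym S S') (dim_Msym k n p q)
     (realify (n := n) @` MsymT S S' V) (dim_Msym k n p q)).
Proof.
rewrite hq in hqp *; split; [split|split; [split|]].
- exact: exists_MsymT.
- by move=> W hW; exact: MsymT_indep.
- exact: open_MsymT.
- exact: dense_MsymT.
- exact: embedded_Msym.
Qed.
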